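(* Let $(A,\cdot,[-,-],\varepsilon)$ be a non-commutative Leibniz-Poisson color algebra. Then $(A,\cdot,[-,[-,-]],\varepsilon)$, i.e. $A$ with the same product and the ternary bracket $[x,y,z]:=[x,[y,z]]$, is a non-commutative ternary Leibniz-Nambu-Poisson color algebra.
   Context: $\mathbb{K}$ is a field of characteristic different from 2 and $G$ is an abelian group. A bicharacter is a map $\varepsilon:G\times G\to\mathbb{K}^*$ with $\varepsilon(a,b)\varepsilon(b,a)=1$, $\varepsilon(a,b+c)=\varepsilon(a,b)\varepsilon(a,c)$, $\varepsilon(a+b,c)=\varepsilon(a,c)\varepsilon(b,c)$. For a $G$-graded vector space $V=\bigoplus_{a\in G}V_a$ over $\mathbb{K}$, $\mathcal{H}(V)$ denotes the set of homogeneous elements. For homogeneous $x,y,z$ one writes $\varepsilon(x,y)$ for $\varepsilon(\deg x,\deg y)$, $\varepsilon(x,y+z)$ for $\varepsilon(\deg x,\deg y+\deg z)$, etc. A multilinear map is even if the degree of its value on homogeneous elements is the sum of their degrees. A non-commutative Leibniz-Poisson color algebra is a quadruple $(P,\cdot,[-,-],\varepsilon)$, with $P$ a $G$-graded vector space, $\cdot$ and $[-,-]$ even bilinear maps $P\otimes P\to P$ and $\varepsilon$ a bicharacter, such that for all $x,y,z\in\mathcal{H}(P)$: $(x\cdot y)\cdot z=x\cdot(y\cdot z)$; $[[x,y],z]=[x,[y,z]]+\varepsilon(y,z)[[x,z],y]$; $[x\cdot y,z]=x\cdot[y,z]+\varepsilon(y,z)[x,z]\cdot y$. A non-commutative ternary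 Leibniz-Nambu-Poisson color algebra is a quadruple $(A,\cdot,[-,-,-],\varepsilon)$, with $A$ a $G$-graded vector space, $\cdot$ even bilinear, $[-,-,-]$ even trilinear and $\varepsilon$ a bicharacter, such that for all $x,y,z,t,u\in\mathcal{H}(A)$: 1) $(x\cdot y)\cdot z=x\cdot(y\cdot z)$; 2) $[[x,y,z],t,u]=[x,y,[z,t,u]]+\varepsilon(z,t+u)[x,[y,t,u],z]+\varepsilon(y+z,t+u)[[x,t,u],y,z]$; 3) $[x\cdot y,z,t]=x\cdot[y,z,t]+\varepsilon(y,z+t)[x,z,t]\cdot y$. *)

(* Defs.v *)
From HB Require Import structures.
From mathcomp Require Import all_boot all_order all_algebra.

Set Implicit Arguments.
Unset Strict Implicit.
Unset Printing Implicit Defensive.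

Import GRing.Theory.
Local Open Scope ring_scope.

(* The internal direct sum decomposition V = \bigoplus_(a : G) comp a. Both G
   and V may be infinite(-dimensional), and a component is an arbitrary linear
   subspace, so it is a Prop-valued (not necessarily decidable) predicate. *)
Record grading (G : zmodType) (K : fieldType) (V : lmodType K) := Grading {
  comp :> G -> V -> Prop;
  comp0 : forall a, comp a 0;
  comp_linear : forall a (k : K) u v,
    comp a u -> comp a v -> comp a (k *: u + v);
  comp_span : forall v, exists s : seq G, exists f : G -> V,
    [/\ uniq s, forall a, comp a (f a) & v = \sum_(a <- s) f a];
  comp_direct : forall (s : seq G) (f : G -> V),
    uniq s -> (forall a, comp a (f a)) -> \sum_(a <- s) f a = 0 ->
    forall a, a \in s -> f a = 0
}.

Record bicharacter (G : zmodType) (K : fieldType) (eps : G -> G -> K) : Prop :=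
  Bicharacter {
    bichar_neq0 : forall a b, eps a b != 0;
    bichar_skew : forall a b, eps a b * eps b a = 1;
    bicharDr : forall a b c, eps a (b + c) = eps a b * eps a c;
    bicharDl : forall a b c, eps (a + b) c = eps a c * eps b c
  }.

Definition bilinear_map (K : fieldType) (V : lmodType K) (m : V -> V -> V) :=
  bilinear_for *:%R *:%R m.

Definition trilinear_map (K : fieldType) (V : lmodType K)
    (t : V -> V -> V -> V) :=
  [/\ forall y z, linear (fun x => t x y z),
      forall x z, linear (fun y => t x y z)
    & forall x y, linear (fun z => t x y z)].

Definition even2 (G : zmodType) (K : fieldType) (V : lmodType K)
    (V_ : grading G V) (m : V -> V -> V) :=
  forall a b x y, V_ a x -> V_ b y -> V_ (a + b) (m x y).

Definition even3 (G : zmodType) (K : fieldType) (V : lmodType K)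
    (V_ : grading G V) (t : V -> V -> V -> V) :=
  forall a b c x y z, V_ a x -> V_ b y -> V_ c z -> V_ (a + b + c) (t x y z).

(* Identities over homogeneous elements are quantified over the elements
   together with their degrees: a, b, c, d, e are degrees of x, y, z, t, u.
   The degree is unique for a nonzero element; the zero element belongs to
   every component, and any choice of its degree gives the same identity by
   multilinearity. *)
Record nc_leibniz_poisson_color (G : zmodType) (K : fieldType) (P : lmodType K)
    (P_ : grading G P) (mul br : P -> P -> P) (eps : G -> G -> K) : Prop :=
  NCLeibnizPoissonColor {
    lp_bichar : bicharacter eps;
    lp_mul_bilinear : bilinear_map mul;
    lp_mul_even : even2 P_ mul;
    lp_br_bilinear : bilinear_map br;
    lp_br_even : even2 P_ br;
    lp_mulA : forall a b c x y z, P_ a x -> P_ b y -> P_ c z ->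
      mul (mul x y) z = mul x (mul y z);
    lp_leibniz : forall a b c x y z, P_ a x -> P_ b y -> P_ c z ->
      br (br x y) z = br x (br y z) + eps b c *: br (br x z) y;
    lp_poisson : forall a b c x y z, P_ a x -> P_ b y -> P_ c z ->
      br (mul x y) z = mul x (br y z) + eps b c *: mul (br x z) y
  }.

Record nc_ternary_leibniz_nambu_poisson_color (G : zmodType) (K : fieldType)
    (A : lmodType K) (A_ : grading G A) (mul : A -> A -> A)
    (br3 : A -> A -> A -> A) (eps : G -> G -> K) : Prop :=
  NCTernaryLeibnizNambuPoissonColor {
    lnp_bichar : bicharacter eps;
    lnp_mul_bilinear : bilinear_map mul;
    lnp_mul_even : even2 A_ mul;
    lnp_br_trilinear : trilinear_map br3;
    lnp_br_even : even3 A_ br3;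
    lnp_mulA : forall a b c x y z, A_ a x -> A_ b y -> A_ c z ->
      mul (mul x y) z = mul x (mul y z);
    lnp_nambu : forall a b c d e x y z t u,
      A_ a x -> A_ b y -> A_ c z -> A_ d t -> A_ e u ->
      br3 (br3 x y z) t u
        = br3 x y (br3 z t u)
          + eps c (d + e) *: br3 x (br3 y t u) z
          + eps (b + c) (d + e) *: br3 (br3 x t u) y z;
    lnp_poisson : forall a b c d x y z t,
      A_ a x -> A_ b y -> A_ c z -> A_ d t ->
      br3 (mul x y) z t
        = mul x (br3 y z t) + eps b (c + d) *: mul (br3 x z t) y
  }.

(* Main.v *)
Require Import Defs.
From HB Require Import structures.
From mathcomp Require Import all_boot all_order all_algebra.

Import GRing.Theory.

(** The color Leibniz identity says that right bracketing by a homogeneous [w]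
    is a color derivation of the bracket, and the Poisson identity says that it
    is one of the product.  The ternary axioms say the same of the operator
    [x |-> br3 x t u], which for [br3 x y z = [x, [y, z]]] is right bracketing
    by the single element [w = [t, u]]; as the bracket is even, [w] is
    homogeneous and its degree is the sum of those of [t] and [u].  Hence the
    ternary Poisson rule is the binary one at [w], and the Nambu identity
    follows by applying the derivation rule to the two nested brackets of
    [[x, [y, z]]], which is [nested_bracket_derivation]. *)

Local Open Scope ring_scope.

(** The factor in the middle term comes from moving [w] past [z] inside the inner
    bracket, the one in the last term from moving [w] past [[y, z]], whose
    degree is [b + c] since the bracket is even. *)
Lemma nested_bracket_derivation (K : fieldType) (G : zmodType) (A : lmodType K)
    (A_ : grading G A) (mul br : A -> A -> A) (eps : G -> G -> K) :
  nc_leibniz_poisson_color A_ mul br eps ->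
  forall a b c d x y z w, A_ a x -> A_ b y -> A_ c z -> A_ d w ->
    br (br x (br y z)) w
      = br x (br y (br z w))
        + eps c d *: br x (br (br y w) z)
        + eps (b + c) d *: br (br x w) (br y z).
Proof.
move=> P a b c d x y z w Ax Ay Az Aw.
have Ayz := lp_br_even P Ay Az.
have [_ linr] := lp_br_bilinear P.
rewrite (lp_leibniz P Ax Ayz Aw) (lp_leibniz P Ay Az Aw).
by rewrite [br y _ + _]addrC linr [_ *: _ + br x _]addrC.
Qed.

Theorem theorem4p5 (K : fieldType) (charK : 2%N \notin [pchar K])
    (G : zmodType) (A : lmodType K) (A_ : grading G A)
    (mul br : A -> A -> A) (eps : G -> G -> K) :
  nc_leibniz_poisson_color A_ mul br eps ->
  nc_ternary_leibniz_nambu_poisson_color A_ mul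
    (fun x y z => br x (br y z)) eps.
Proof.
move=> P; have [linl linr] := lp_br_bilinear P.
split.
- exact: lp_bichar P.
- exact: lp_mul_bilinear P.
- exact: lp_mul_even P.
- split=> [y z | x z | x y] k u v.
  + exact: linl.
  + by rewrite (linl z) (linr x).
  + by rewrite (linr y) (linr x).
- move=> a b c x y z Ax Ay Az; rewrite -addrA.
  exact: lp_br_even P _ _ _ _ Ax (lp_br_even P Ay Az).
- exact: lp_mulA P.
- move=> a b c d e x y z t u Ax Ay Az At Au.
  exact: nested_bracket_derivation P _ _ _ _ _ _ _ _ Ax Ay Az
    (lp_br_even P At Au).
- move=> a b c d x y z t Ax Ay Az At.
  exact: lp_poisson P _ _ _ _ _ _ Ax Ay (lp_br_even P Az At).
Qed.
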